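(* Let $m,n\ge2$ be integers, let $\mathcal{A}\in T_{m,n}$, let $N=\binom{m+n-2}{n-1}$, and let $\bar{A}\in\mathbb{R}^{N\times N}$ be the auxiliary matrix of $\mathcal{A}$. Suppose that for every $\bar q\in\mathbb{R}^N$ the linear complementarity problem $LCP(\bar q,\bar A)$ has a unique $w$-solution, in the sense that any two solutions $y^1,y^2$ of $LCP(\bar q,\bar A)$ satisfy $\bar A y^1+\bar q=\bar A y^2+\bar q$. Then for every $q\in\mathbb{R}^n$ the tensor complementarity problem $TCP(q,\mathcal{A})$ has a unique $\omega$-solution, if one exists; that is, any two solutions $x^1,x^2$ of $TCP(q,\mathcal{A})$ satisfy $\mathcal{A}(x^1)^{m-1}+q=\mathcal{A}(x^2)^{m-1}+q$.
   Context: $[n]=\{1,\dots,n\}$. $T_{m,n}$ denotes the set of real tensors $\mathcal{A}=(a_{i_1 i_2\cdots i_m})$ of order $m$ and dimension $n$. For $x\in\mathbb{R}^n$, $\mathcal{A}x^{m-1}\in\mathbb{R}^n$ is the vector with components $(\mathcal{A}x^{m-1})_i=\sum_{i_2,\dots,i_m=1}^n a_{i i_2\cdots i_m}x_{i_2}\cdots x_{i_m}$. Vector inequalities are componentwise. $TCP(q,\mathcal{A})$, for $q\in\mathbb{R}^n$: find $x\in\mathbb{R}^n$ with $x\ge0$, $\omega=\mathcal{A}x^{m-1}+q\ge0$, $x^T\omega=0$. $LCP(p,M)$, for $M\in\mathbb{R}^{k\times k}$, $p\in\mathbb{R}^k$: find $z\in\mathbb{R}^k$ with $z\ge0$, $w=Mz+p\ge0$,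 $z^Tw=0$. Auxiliary matrix: $N$ is the number of monomials of degree $m-1$ in $x_1,\dots,x_n$. List these monomials in modified graded lexicographic order: first the pure powers $x_1^{m-1},x_2^{m-1},\dots,x_n^{m-1}$, then the monomials involving at least two distinct variables in decreasing lexicographic order (with $x_1>x_2>\cdots>x_n$), i.e. $x_1^{m-2}x_2,\dots,x_1x_n^{m-2},\dots$. Let $A\in\mathbb{R}^{n\times N}$ be the matrix whose $(i,j)$ entry is the coefficient of the $j$-th monomial in the polynomial $(\mathcal{A}x^{m-1})_i$. The auxiliary matrix is $\bar A=\begin{pmatrix}A\\O\end{pmatrix}\in\mathbb{R}^{N\times N}$, where $O$ is the $(N-n)\times N$ zero matrix. *)

(* Defs.v *)
From mathcomp Require Import all_boot all_order all_algebra.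
From mathcomp Require Import reals.
From mathcomp Require Import mpoly.

Set Implicit Arguments.
Unset Strict Implicit.
Unset Printing Implicit Defensive.

Import Order.TTheory GRing.Theory Num.Theory.
Local Open Scope ring_scope.

(* A tensor of order m and dimension n; indices are 0-based, so the entry
   a_{i_1 ... i_m} is the value at the tuple (i_1 - 1, ..., i_m - 1). *)
Definition tensor (R : realType) (m n : nat) := m.-tuple 'I_n -> R.

Section TensorComplementarity.
Context (R : realType).

(* The vector A x^(m-1). For m > 0, summing over the index tuples t of length m
   whose head is i amounts to summing over (i_2, ..., i_m) = behead t. *)
Definition tensor_app (m n : nat) (A : tensor R m n) (x : 'cV[R]_n) : 'cV[R]_n :=
  \col_i \sum_(t : m.-tuple 'I_n | ohead t == Some i)
            A t * \prod_(j <- behead t) x j 0.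

Definition nonneg_vec (k : nat) (x : 'cV[R]_k) : Prop := forall i, 0 <= x i 0.

Definition TCP_solution (m n : nat) (q : 'cV[R]_n) (A : tensor R m n)
    (x : 'cV[R]_n) : Prop :=
  let w := tensor_app A x + q in
  [/\ nonneg_vec x, nonneg_vec w & x^T *m w = 0].

Definition LCP_solution (k : nat) (p : 'cV[R]_k) (M : 'M[R]_k)
    (z : 'cV[R]_k) : Prop :=
  let w := M *m z + p in
  [/\ nonneg_vec z, nonneg_vec w & z^T *m w = 0].

(* (A x^(m-1))_i as a polynomial in the variables x_1, ..., x_n. *)
Definition tensor_poly (m n : nat) (A : tensor R m n) (i : 'I_n) : {mpoly R[n]} :=
  \sum_(t : m.-tuple 'I_n | ohead t == Some i)
     A t *: \prod_(j <- behead t) 'X_j.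

End TensorComplementarity.

Definition num_monomials (m n : nat) : nat := 'C(m + n - 2, n - 1).

Definition pure_powers (m n : nat) : seq 'X_{1..n} :=
  [seq (U_(i) *+ m.-1)%MM | i <- enum 'I_n].

(* The order on 'X_{1..n} is the graded lexicographic one with
   x_1 > x_2 > ... > x_n; on monomials of equal degree it is lexicographic. *)
Definition mixed_monomials (m n : nat) : seq 'X_{1..n} :=
  sort (fun e1 e2 : 'X_{1..n} => (e2 <= e1)%O)
    [seq bmnm e | e : 'X_{1..n < m} <- enum {: 'X_{1..n < m}}
                & (mdeg e == m.-1) && (1 < #|[pred i | e i != 0%N]|)%N].

Definition monomials (m n : nat) : seq 'X_{1..n} :=
  pure_powers m n ++ mixed_monomials m n.

(* The default value of nth is never reached when 1 < m and 0 < n: see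
   size_monomials below. *)
Definition coef_matrix (R : realType) (m n : nat) (A : tensor R m n) :
    'M[R]_(n, num_monomials m n) :=
  \matrix_(i, j) (tensor_poly A i)@_(nth 0%MM (monomials m n) j).

(* The matrix A completed by zero rows: row i of the result is row i of A when
   i < n (that is, when [insub i : option 'I_n] is [Some k] with k = i). *)
Definition aux_matrix (R : realType) (m n : nat) (A : tensor R m n) :
    'M[R]_(num_monomials m n) :=
  \matrix_(i, j) if insub (val i) is Some k then coef_matrix A k j else 0.

Lemma mem_monomials (m n : nat) (e : 'X_{1..n}) :
  (1 < m)%N -> (e \in monomials m n) = (mdeg e == m.-1).
Proof.
move=> m_gt1; rewrite mem_cat mem_sort; apply/idP/idP.
  case/orP => [/mapP[i _ ->]|/mapP[b]]; first by rewrite mdegMn mdeg1 mul1n.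
  by rewrite mem_filter => /andP[/andP[bm _] _] ->.
move=> em; have [e_gt1|e_le1] := ltnP 1 #|[pred i | e i != 0%N]|.
  have eb : (mdeg e < m)%N by rewrite (eqP em) prednK // (ltn_trans _ m_gt1).
  apply/orP; right; apply/mapP; exists (BMultinom eb) => //.
  by rewrite mem_filter mem_enum em e_gt1.
have /existsP[i ei] : [exists i, e i != 0%N].
  apply: contraLR em => /existsPn e0; rewrite mdegE big1 => [|i _].
    by rewrite eq_sym -lt0n -ltnS prednK // (ltn_trans _ m_gt1).
  by apply/eqP; move: (e0 i); rewrite negbK.
have ej j : j != i -> e j = 0%N.
  move=> ji; apply/eqP; apply: contraLR e_le1 => ej.
  rewrite -ltnNge; apply/card_gt1P; exists i, j; split=> //.
  by rewrite eq_sym.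
apply/orP; left; apply/mapP; exists i; rewrite ?mem_enum //.
apply/mnmP => j; rewrite mulmnE mnm1E -(eqP em) mdegE (bigD1 i) //= big1 //.
rewrite addn0; case: eqP => [<-|/eqP ij]; first by rewrite mul1n.
by rewrite mul0n ej // eq_sym.
Qed.

Lemma uniq_monomials (m n : nat) : (1 < m)%N -> uniq (monomials m n).
Proof.
move=> m_gt1; have m1 : (0 < m.-1)%N by rewrite -ltnS prednK // (ltn_trans _ m_gt1).
have mnmU (i j : 'I_n) : (U_(i) *+ m.-1)%MM j = (if i == j then m.-1 else 0)%N.
  by rewrite mulmnE mnm1E; case: eqP; rewrite ?mul1n ?mul0n.
rewrite cat_uniq sort_uniq; apply/and3P; split.
- rewrite map_inj_uniq ?enum_uniq // => i j /mnmP/(_ j); rewrite !mnmU eqxx.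
  by case: (i =P j) => // _ m0; rewrite -m0 in m1.
- apply/hasPn => e; rewrite mem_sort => /mapP[b + ->].
  rewrite mem_filter => /andP[/andP[_ /card_gt1P[j [k [ej ek jk]]]] _].
  apply/mapP => -[i _ be]; move: ej ek; rewrite !inE be !mnmU.
  case: (i =P j) => // ij _; case: (i =P k) => // ik _.
  by rewrite -ij -ik eqxx in jk.
- rewrite map_inj_uniq; first by rewrite filter_uniq ?enum_uniq.
  by move=> b1 b2 ?; exact: val_inj.
Qed.

Lemma size_monomials (m n : nat) :
  (1 < m)%N -> (0 < n)%N -> size (monomials m n) = num_monomials m n.
Proof.
case: m n => [|m] [|n] // m_gt1 _.
rewrite /num_monomials addSn addnS !subSS !subn0 -bin_sub ?leq_addl //.
rewrite addnK -size_basis.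
apply/perm_size/uniq_perm; rewrite ?uniq_monomials ?uniq_basis // => e.
by rewrite mem_monomials // basis_cover.
Qed.

(* Main.v *)
(* Evaluating all monomials of degree m-1 at a solution x of TCP(q, A) gives a
   solution of LCP((q, 0), aux_matrix A), with w-part (A x^(m-1) + q, 0):
   complementarity survives because the first n monomials are the pure powers
   x_i^(m-1), and x_i w_i = 0. So uniqueness of w forces that of omega. *)

Require Import Defs.
From mathcomp Require Import all_boot all_order all_algebra.
From mathcomp Require Import reals.
From mathcomp Require Import mpoly.

Set Implicit Arguments.
Unset Strict Implicit.
Unset Printing Implicit Defensive.

Import GRing.Theory Num.Theory.
Local Open Scope ring_scope.

(** Entries of [s] outside the support have coefficient 0. This allows a polynomial to be evaluated
    along a prescribed list of monomials, in its own order. *)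
Lemma meval_uniq_sum (R : comNzRingType) (n : nat) (p : {mpoly R[n]})
    (v : 'I_n -> R) (s : seq 'X_{1..n}) :
  uniq s -> {subset msupp p <= s} ->
  p.@[v] = \sum_(e <- s) p@_e * \prod_i v i ^+ e i.
Proof.
move=> s_uniq sub_ps; rewrite mevalE.
rewrite [RHS](bigID (fun e => e \in msupp p)) /= addrC.
rewrite [X in _ = X + _]big1 ?add0r; last first.
  by move=> e /memN_msupp_eq0 ->; rewrite mul0r.
rewrite -[RHS]big_filter; apply/perm_big/uniq_perm; rewrite ?filter_uniq //.
move=> e; rewrite mem_filter.
by case: (boolP (e \in msupp p)) => // /sub_ps ->.
Qed.

(** A sum of nonnegative terms vanishes only if each term does. The componentwise form of
    complementarity can be carried from dimension [n] to dimension [num_monomials m n]. *)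
Lemma nonneg_dot_eq0 (R : realType) (k : nat) (z w : 'cV[R]_k) :
  nonneg_vec z -> nonneg_vec w ->
  z^T *m w = 0 <-> forall i, z i 0 * w i 0 = 0.
Proof.
move=> z0 w0; split=> [/matrixP/(_ 0 0)|zw].
  rewrite !mxE; under eq_bigr => i _ do rewrite mxE.
  by move=> /psumr_eq0P zw i; apply: zw => // j _; rewrite mulr_ge0.
by apply/matrixP => i j; rewrite !mxE big1 // => k' _; rewrite mxE !ord1.
Qed.

Section Lift.
Context (R : realType) (m n : nat).
Hypotheses (hm : (2 <= m)%N) (hn : (0 < n)%N).
Implicit Types (A : tensor R m n) (x q w : 'cV[R]_n).

Lemma msupp_tensor_poly A (i : 'I_n) :
  {subset msupp (tensor_poly A i) <= monomials m n}.
Proof.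
(* Each term is a scalar times a product of [m.-1] variables, and [monomials m n] lists every
   monomial of that degree. *)
have homA : tensor_poly A i \is m.-1.-homog.
  apply: rpred_sum => t _; apply: rpredZ.
  have -> : m.-1 = size (behead t) by rewrite size_behead size_tuple.
  elim: (behead t : seq _) => [|j s IHs]; first by rewrite big_nil dhomog1.
  by rewrite big_cons /= -add1n dhomogM // dhomogX /= mdeg1.
by move=> e /(dhomog_mf homA) de; rewrite mem_monomials ?de.
Qed.

Lemma tensor_appE A x (i : 'I_n) :
  tensor_app A x i 0 = (tensor_poly A i).@[fun j => x j 0].
Proof.
rewrite mxE /tensor_poly raddf_sum /=; apply: eq_bigr => t _.
rewrite mevalZ rmorph_prod /=; congr (_ * _).
by apply: eq_bigr => j _; rewrite mevalXU.
Qed.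

Definition monomial_vec x : 'cV[R]_(num_monomials m n) :=
  \col_j \prod_i x i 0 ^+ (nth 0%MM (monomials m n) j) i.

(** The [insub] test is that of [aux_matrix], so one case analysis settles both. *)
Definition pad_vec q : 'cV[R]_(num_monomials m n) :=
  \col_j if insub (val j) is Some k then q k 0 else 0.

Lemma leq_num_monomials : (n <= num_monomials m n)%N.
Proof.
by rewrite -size_monomials // size_cat size_map size_enum_ord leq_addr.
Qed.

Lemma pad_vecE q (i : 'I_n) : pad_vec q (widen_ord leq_num_monomials i) 0 = q i 0.
Proof. by rewrite mxE valK. Qed.

(** The modified order matters here: with the pure powers listed first, row [i] of the tensor is
    paired with a power of [x i 0] alone. *)
Lemma monomial_vec_pure x (j : 'I_(num_monomials m n)) (i : 'I_n) :
  val j = val i -> monomial_vec x j 0 = x i 0 ^+ m.-1.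
Proof.
move=> ji; rewrite mxE ji nth_cat size_map size_enum_ord ltn_ord.
rewrite (nth_map i) ?size_enum_ord //= nth_ord_enum (bigD1 i) //=.
rewrite mulmnE mnm1E eqxx mul1n big1 ?mulr1 // => k ki.
by rewrite mulmnE mnm1E eq_sym (negbTE ki) mul0n expr0.
Qed.

Lemma aux_matrix_monomial_vec A q x :
  aux_matrix A *m monomial_vec x + pad_vec q = pad_vec (tensor_app A x + q).
Proof.
apply/matrixP => i k; rewrite !mxE.
under eq_bigr => j _ do rewrite [aux_matrix A i j]mxE.
case: insubP => [l _ _|_]; last first.
  by rewrite big1 ?addr0 // => j _; rewrite mul0r.
rewrite [RHS]mxE tensor_appE; congr (_ + _).
(* A nonzero row holds the coefficients of [tensor_poly A l], so its product with the monomial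
   vector is the value of that polynomial at [x]. *)
rewrite (meval_uniq_sum _ (uniq_monomials _ hm) (@msupp_tensor_poly A l)).
rewrite (big_nth 0%MM) size_monomials // big_mkord.
by apply: eq_bigr => j _; rewrite !mxE.
Qed.

Lemma nonneg_monomial_vec x : nonneg_vec x -> nonneg_vec (monomial_vec x).
Proof. by move=> x0 j; rewrite mxE prodr_ge0 // => i _; rewrite exprn_ge0. Qed.

Lemma nonneg_pad_vec w : nonneg_vec w -> nonneg_vec (pad_vec w).
Proof. by move=> w0 j; rewrite mxE; case: insub. Qed.

Lemma LCP_solution_monomial_vec A q x :
  TCP_solution q A x -> LCP_solution (pad_vec q) (aux_matrix A) (monomial_vec x).
Proof.
case=> x0 w0 /(nonneg_dot_eq0 x0 w0) xw.
have y0 := nonneg_monomial_vec x0; have pw0 := nonneg_pad_vec w0.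
rewrite /LCP_solution aux_matrix_monomial_vec; split=> //.
apply/(nonneg_dot_eq0 y0 pw0) => j; rewrite [pad_vec _ j 0]mxE.
case: insubP => [k _ kj|_]; last by rewrite mulr0.
rewrite (monomial_vec_pure x (esym kj)).
(* Since [m.-1] is positive, one factor [x k 0] can be split off the pure power and paired with the
   slack, where their product is 0. *)
have -> : m.-1 = m.-2.+1 by case: m hm => [|[]].
by rewrite exprSr -mulrA xw mulr0.
Qed.

End Lift.

Theorem theorem3p8 (R : realType) (m n : nat) (hm : (2 <= m)%N) (hn : (2 <= n)%N)
  (A : tensor R m n)
  (hLCP : forall (qbar y1 y2 : 'cV[R]_(num_monomials m n)),
     LCP_solution qbar (aux_matrix A) y1 ->
     LCP_solution qbar (aux_matrix A) y2 ->
     aux_matrix A *m y1 + qbar = aux_matrix A *m y2 + qbar) :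
  forall q x1 x2 : 'cV[R]_n,
    TCP_solution q A x1 -> TCP_solution q A x2 ->
    tensor_app A x1 + q = tensor_app A x2 + q.
Proof.
move=> q x1 x2 s1 s2; have n_gt0 := ltnW hn.
have := hLCP _ _ _ (LCP_solution_monomial_vec hm n_gt0 s1)
                   (LCP_solution_monomial_vec hm n_gt0 s2).
rewrite !aux_matrix_monomial_vec // => /matrixP eq_pad.
(* Padding loses nothing: the first [n] coordinates give back the original vector. *)
apply/matrixP => i k; rewrite ord1 -2!(pad_vecE hm n_gt0).
exact: eq_pad.
Qed.
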